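(* Let $\mathbb{F}_q$ be a finite field with $q$ elements, let $V$ be an $\mathbb{F}_q$-vector space of finite dimension $n\ge 1$, and let $G$ be a group acting linearly on $V$. Let $(a_1,\dots,a_r)$ be a composition of $n$. Then for every permutation $\sigma\in\mathfrak{S}_r$, $$N(G,\mathrm{Fl}_{(a_1,\dots,a_r)}(V))=N(G,\mathrm{Fl}_{(a_{\sigma(1)},\dots,a_{\sigma(r)})}(V)).$$
   Context: A composition of $n$ of length $r$ ($r\ge 1$) is an $r$-tuple $(a_1,\dots,a_r)$ of nonnegative integers with $a_1+\dots+a_r=n$. $\mathfrak{S}_r$ is the group of permutations of $\{1,\dots,r\}$. For a composition $(a_1,\dots,a_r)$ of $n$, $\mathrm{Fl}_{(a_1,\dots,a_r)}(V)$ is the (finite) set of flags $0=V_0\subset V_1\subset\dots\subset V_r=V$ of $\mathbb{F}_q$-linear subspaces of $V$ with $\dim V_i/V_{i-1}=a_i$ for all $i$. The action of $G$ on $V$ induces an action of $G$ on it. For a group $G$ acting on a finite set $E$, $N(G,E)$ is the number of orbits. *)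

(* Defs.v *)
(* Uses MathComp, with classical decidability (boolp). *)
From HB Require Import structures.
From mathcomp Require Export all_boot all_order all_fingroup all_algebra.
From mathcomp Require Export boolp.

Set Implicit Arguments.
Unset Strict Implicit.
Unset Printing Implicit Defensive.

Import GRing.Theory.
Local Open Scope ring_scope.

(* Over a finite field, the subspaces of V form a finite type. *)
Section FinVspace.
Import VectorInternalTheory.
Variables (F : finFieldType) (V : vectType F).
HB.instance Definition _ := [Countable of {vspace V} by <:].
HB.instance Definition _ := [Finite of {vspace V} by <:].
End FinVspace.

(* [a i] stands for a_(i+1), for i = 0, ..., r-1. *)
Definition composition (n r : nat) (a : 'I_r -> nat) : Prop :=
  (0 < r)%N /\ (\sum_(i < r) a i)%N = n.

(* A linear action of a possibly infinite group. *)
Definition linear_action (F : fieldType) (V : vectType F) (G : groupType)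
    (rho : G -> 'End(V)) : Prop :=
  (forall v, rho 1%g v = v) /\
  (forall g h v, rho (g * h)%g v = rho g (rho h v)).

Section Flags.
Variables (F : finFieldType) (V : vectType F).

(* [widen_ord (leqnSn r) i] and [lift ord0 i] are the indices i and i+1 in
   {0, ..., r}. Inclusions need not be strict, since parts may be 0. *)
Definition Fl (r : nat) (a : 'I_r -> nat) : {set {ffun 'I_r.+1 -> {vspace V}}} :=
  [set f : {ffun 'I_r.+1 -> {vspace V}} |
    [&& f ord0 == 0%VS, f ord_max == fullv &
      [forall i : 'I_r,
        (f (widen_ord (leqnSn r) i) <= f (lift ord0 i))%VS &&
        (\dim (f (lift ord0 i)) - \dim (f (widen_ord (leqnSn r) i)) == a i)%N]]].

Definition flag_act (G : groupType) (rho : G -> 'End(V)) (r : nat)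
    (g : G) (f : {ffun 'I_r.+1 -> {vspace V}}) : {ffun 'I_r.+1 -> {vspace V}} :=
  [ffun i => (rho g @: f i)%VS].

End Flags.

Definition group_orbit (G : groupType) (T : finType) (to : G -> T -> T) (x : T) :
    {set T} :=
  [set y | `[< exists g, to g x = y >]].

(* The number of orbits of G on a G-stable subset E of T. *)
Definition norbits (G : groupType) (T : finType) (to : G -> T -> T)
    (E : {set T}) : nat :=
  #|[set group_orbit to x | x in E]|.

(* G does act on each set of flags. *)
Section FlagAction.
Variables (F : finFieldType) (V : vectType F) (G : groupType).
Variables (rho : G -> 'End(V)) (r : nat).
Hypothesis rhoP : linear_action rho.
Implicit Types (g h : G) (f : {ffun 'I_r.+1 -> {vspace V}}).

Lemma flag_act1 f : flag_act rho 1%g f = f.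
Proof.
apply/ffunP=> i; rewrite ffunE; have -> : rho 1%g = \1%VF.
  by apply/lfunP=> v; rewrite id_lfunE rhoP.1.
exact: lim1g.
Qed.

Lemma flag_actM g h f : flag_act rho (g * h)%g f = flag_act rho g (flag_act rho h f).
Proof.
apply/ffunP=> i; rewrite !ffunE -limg_comp; congr (_ @: _)%VS.
by apply/lfunP=> v; rewrite comp_lfunE rhoP.2.
Qed.

Lemma lker_linear_action g : lker (rho g) == 0%VS.
Proof.
apply/lker0P=> u v /(congr1 (rho g^-1%g)).
by rewrite -!rhoP.2 mulVg !rhoP.1.
Qed.

Lemma Fl_stable (a : 'I_r -> nat) g f : f \in Fl V a -> flag_act rho g f \in Fl V a.
Proof.
have dimg U : \dim (rho g @: U) = \dim U.
  by apply: limg_dim_eq; rewrite (eqP (lker_linear_action g)) capv0.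
rewrite !inE => /and3P[/eqP f0 /eqP fr /forallP fP].
rewrite !ffunE f0 fr limg0 eqxx eqEdim subvf dimg leqnn /=.
apply/forallP=> i; case/andP: (fP i) => sub /eqP <-.
by rewrite !ffunE !dimg eqxx limgS.
Qed.

End FlagAction.

(* Main.v *)
Require Import Defs.

(** Replacing [G] by its image in a finite group of permutations, the
    Cauchy-Frobenius formula [norbits_eq] reduces the statement to a single
    linear automorphism [f] of [V]: the number of [f]-stable flags with parts
    [a_1, ..., a_r] must not depend on the order of the parts. It suffices to
    exchange two consecutive parts [x] and [y]. With the other terms of the flag
    fixed, this means that for [f]-stable subspaces [P <= Q] with
    [dim (Q / P) = x + y], there are as many stable subspaces of dimension [x] in
    [Q / P] as there are of dimension [y] ([flag_step_swap]).

    That is a duality statement. Taking annihilators is a bijection between the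
    stable subspaces of [Q / P] of dimension [x] and those of dimension [y] of
    its dual, and [Q / P] is isomorphic to its dual as a module over [F[X]],
    because a square matrix over a field is similar to its transpose
    ([similar_trmx]). Equivalently, [Q / P] carries a nondegenerate bilinear form
    for which [f] is its own adjoint ([adjoint_form]), and the orthogonal of a
    stable subspace is stable ([stable_interval_duality]).

    The similarity of [A] and [A^T] comes from the polynomial matrix ['X - A].
    Over a Euclidean domain each square matrix is equivalent to a diagonal one,
    hence to its own transpose ([mx_equiv_trmx]); and an equivalence between
    ['X - A] and ['X - A^T] yields a similarity of [A] and [A^T] by evaluation of
    polynomials with matrix coefficients. *)

Set Implicit Arguments.
Unset Strict Implicit.
Unset Printing Implicit Defensive.
Import GRing.Theory.
Local Open Scope ring_scope.

(** * Equivalence of polynomial matrices *)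

(** Equivalence of matrices: equality up to invertible row and column
    operations. *)
Definition mx_equiv (R : comUnitRingType) (m n : nat)
    (A B : 'M[R]_(m, n)) : Prop :=
  exists P Q, [/\ P \in unitmx, Q \in unitmx & B = P *m A *m Q].

Section MxEquiv.
Variable R : comUnitRingType.

Lemma mx_equiv_refl m n (A : 'M[R]_(m, n)) : mx_equiv A A.
Proof. by exists 1%:M, 1%:M; rewrite !unitmx1 mul1mx mulmx1. Qed.

Lemma mx_equiv_trans m n (A B C : 'M[R]_(m, n)) :
  mx_equiv A B -> mx_equiv B C -> mx_equiv A C.
Proof.
move=> [P [Q [uP uQ ->]]] [P' [Q' [uP' uQ' ->]]].
by exists (P' *m P), (Q *m Q'); rewrite !unitmx_mul uP uP' uQ uQ' !mulmxA.
Qed.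

Lemma mx_equiv_sym m n (A B : 'M[R]_(m, n)) : mx_equiv A B -> mx_equiv B A.
Proof.
move=> [P [Q [uP uQ ->]]]; exists (invmx P), (invmx Q).
by rewrite !unitmx_inv uP uQ -!mulmxA mulmxV // mulmx1 mulKmx.
Qed.

Lemma mx_equiv_tr m n (A B : 'M[R]_(m, n)) : mx_equiv A B -> mx_equiv A^T B^T.
Proof.
move=> [P [Q [uP uQ ->]]]; exists Q^T, P^T.
by rewrite !unitmx_tr uP uQ !trmx_mul mulmxA.
Qed.

Lemma mx_equiv_block k n (D : 'M[R]_k) (A B : 'M[R]_n) :
  mx_equiv A B -> mx_equiv (block_mx D 0 0 A) (block_mx D 0 0 B).
Proof.
move=> [P [Q [uP uQ ->]]]; exists (block_mx 1%:M 0 0 P), (block_mx 1%:M 0 0 Q).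
rewrite !unitmxE !det_ublock !det1 !mul1r -!unitmxE uP uQ; split=> //.
by rewrite !mulmx_block !(mulmx0, mul0mx, addr0, add0r, mul1mx, mulmx1).
Qed.

Lemma mx_equiv_xrow m n (A : 'M[R]_(m, n)) i j : mx_equiv A (xrow i j A).
Proof.
by exists (tperm_mx i j), 1%:M; rewrite unitmx_perm unitmx1 mulmx1 -xrowE.
Qed.

Lemma mx_equiv_xcol m n (A : 'M[R]_(m, n)) i j : mx_equiv A (xcol i j A).
Proof.
by exists 1%:M, (tperm_mx i j); rewrite unitmx_perm unitmx1 mul1mx -xcolE.
Qed.

(** Column operations subtracting combinations of the first [k] columns from
    the last [n] ones. *)
Lemma mx_equiv_addr k n (a : 'M[R]_k) u c (D : 'M[R]_n) (v : 'M_(k, n)) :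
  mx_equiv (block_mx a u c D) (block_mx a (u - a *m v) c (D - c *m v)).
Proof.
exists 1%:M, (block_mx 1%:M (- v) 0 1%:M).
rewrite unitmx1 unitmxE det_ublock !det1 mulr1 unitr1 mul1mx; split=> //.
by rewrite mulmx_block !(mulmx0, mulmx1, addr0, mulmxN) ![- _ + _]addrC.
Qed.

End MxEquiv.

Section PolyMx.
Variable F : fieldType.

(** [B] has a nonzero top left entry, of least degree among the nonzero entries
    of all the matrices equivalent to [B]. *)
Definition min_pivot n (B : 'M[{poly F}]_(1 + n)) : Prop :=
  B 0 0 != 0 /\
  forall C i j, mx_equiv B C -> C i j != 0 -> (size (B 0%R 0%R) <= size (C i j))%N.

Lemma min_pivot_tr n (B : 'M[{poly F}]_(1 + n)) : min_pivot B -> min_pivot B^T.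
Proof.
move=> [B0 Bmin]; rewrite /min_pivot mxE; split=> // C i j.
by move=> /mx_equiv_tr; rewrite trmxK => BC; have:= Bmin _ j i BC; rewrite mxE.
Qed.

Lemma exists_min_pivot n (A : 'M[{poly F}]_(1 + n)) : A != 0 ->
  exists2 B, mx_equiv A B & min_pivot B.
Proof.
move=> A0.
pose P s := `[< exists C i j, [/\ mx_equiv A C, C i j != 0 & size (C i j) = s] >].
have exP : exists s, P s.
  have [i [j Aij]] : exists i j, A i j != 0 by apply/matrix0Pn.
  exists (size (A i j)); apply/asboolP; exists A, i, j; split=> //.
  exact: mx_equiv_refl.
case: (ex_minnP exP) => s /asboolP[C [i [j [AC Cij Cs]]]] smin.
pose B := xrow 0%R i (xcol 0%R j C).
have AB : mx_equiv A B.
  apply: mx_equiv_trans AC _.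
  exact: mx_equiv_trans (mx_equiv_xcol C 0%R j) (mx_equiv_xrow _ 0%R i).
exists B => //; rewrite /min_pivot !mxE !tpermL Cs; split=> // C' i' j' BC' C'ij.
apply: smin; apply/asboolP; exists C', i', j'; split=> //.
exact: mx_equiv_trans AB BC'.
Qed.

(** A minimal pivot divides its row: a nonzero remainder of an entry modulo the
    pivot would be an entry of smaller degree in an equivalent matrix. *)
Lemma min_pivot_dvd_row n (B : 'M[{poly F}]_(1 + n)) : min_pivot B ->
  exists v, ursubmx B = ulsubmx B *m v.
Proof.
move=> [B0 Bmin]; exists (map_mx (fun p => p %/ B 0 0) (ursubmx B)).
set v := map_mx _ _; apply/eqP; rewrite -subr_eq0; apply/eqP/rowP=> j.
have:= mx_equiv_addr (ulsubmx B) (ursubmx B) (dlsubmx B) (drsubmx B) v.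
rewrite submxK => BC; have:= Bmin _ (lshift n 0) (rshift 1 j) BC.
rewrite block_mxEur [RHS]mxE; set w := fun_of_matrix _ 0 j => wmin; apply/eqP.
apply: contraTT isT => /wmin; rewrite leqNgt.
suff -> : w = B 0 (rshift 1 j) %% B 0 0 by rewrite ltn_modp B0.
have lshift0 : lshift n 0 = 0 :> 'I_(1 + n) by apply/val_inj.
have Bul : ulsubmx B 0 0 = B 0 0 by rewrite !mxE lshift0.
have Bur : ursubmx B 0 j = B 0 (rshift 1 j) by rewrite !mxE lshift0.
have -> : w = ursubmx B 0 j - ulsubmx B 0 0 * v 0 j.
  by rewrite /w mxE [X in _ + X]mxE [(_ *m _) _ _]mxE big_ord1.
rewrite Bul Bur /v [map_mx _ _ _ _]mxE Bur.
by rewrite {1}(divp_eq (B 0 (rshift 1 j)) (B 0 0)) mulrC addrC addKr.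
Qed.

(** One step of the diagonalisation of a polynomial matrix. *)
Lemma mx_equiv_split n (A : 'M[{poly F}]_(1 + n)) :
  exists d D, mx_equiv A (block_mx (d : 'M_1) 0 0 D).
Proof.
have [->|/exists_min_pivot[B AB minB]] := eqVneq A 0.
  exists 0, 0; rewrite block_mx0; exact: mx_equiv_refl.
have [v Bv] := min_pivot_dvd_row minB.
have [w Bw] := min_pivot_dvd_row (min_pivot_tr minB).
exists (ulsubmx B), (drsubmx B - dlsubmx B *m v).
apply: (mx_equiv_trans AB).
have:= mx_equiv_addr (ulsubmx B) (ursubmx B) (dlsubmx B) (drsubmx B) v.
rewrite submxK Bv subrr => /mx_equiv_trans; apply.
set D := _ - _.
(* The first column is cleared by the transpose of the same operation. *)
have:= mx_equiv_addr (ulsubmx B)^T (dlsubmx B)^T 0 D^T w.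
rewrite mul0mx subr0 trmx_ulsub trmx_dlsub Bw subrr => /mx_equiv_tr.
by rewrite !tr_block_mx -Bw -trmx_ulsub -trmx_dlsub !trmxK !trmx0.
Qed.

(** A square polynomial matrix is equivalent to a diagonal one, which is
    symmetric. *)
Lemma mx_equiv_trmx n (A : 'M[{poly F}]_n) : mx_equiv A A^T.
Proof.
elim: n A => [A|n IHn A].
  by rewrite [A^T]flatmx0 [A]flatmx0; apply: mx_equiv_refl.
have [d [D AD]] := mx_equiv_split (A : 'M_(1 + n)).
apply: (mx_equiv_trans AD); apply: mx_equiv_sym.
apply: mx_equiv_trans (mx_equiv_tr AD) _.
rewrite tr_block_mx !trmx0 (_ : d^T = d); last first.
  by apply/matrixP=> i j; rewrite mxE !ord1.
by apply: mx_equiv_block; apply: mx_equiv_sym.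
Qed.

End PolyMx.

(** * Similarity of a matrix and its transpose *)

(** Evaluation at [a], with coefficients on the left, is not multiplicative over
    a noncommutative ring; this is what remains of multiplicativity when [q.[a]]
    intertwines [a] and [b]. *)
Lemma hornerM_twist (R : nzRingType) (p q : {poly R}) (a b : R) :
  q.[a] * a = b * q.[a] -> (p * q).[a] = p.[b] * q.[a].
Proof.
elim/poly_ind: p q => [|p c IHp] q qa; first by rewrite !mul0r !horner0 mul0r.
rewrite mulrDl -mulrA -commr_polyX hornerD IHp; last first.
  by rewrite !hornerMX qa -mulrA qa.
by rewrite hornerMX hornerCM hornerMXaddC mulrDl qa mulrA.
Qed.

(** A square matrix over a field is similar to its transpose. Let [w] be a unit
    of [{poly 'M_n}] such that [('X - A) w = u ('X - A^T)] for some unit [u].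
    Evaluation at [A^T] kills the right hand side, so [w.[A^T]] intertwines [A]
    and [A^T]; [hornerM_twist] shows that it is invertible, with inverse
    [w^-1.[A]]. *)
Lemma similar_trmx (F : fieldType) n (A : 'M[F]_n) :
  exists2 M, M \in unitmx & A *m M = M *m A^T.
Proof.
case: n A => [|n] A.
  by exists 1%:M; rewrite ?unitmx1 // [LHS]flatmx0 [RHS]flatmx0.
have [phi [_ phiZ phiC _]] := mx_poly_ring_isom F n.
have phi_char B : phi (char_poly_mx B) = 'X - B%:P.
  by rewrite rmorphB phiC phiZ map_polyX.
have [P [Q [uP uQ]]] := mx_equiv_trmx (char_poly_mx A).
have -> : (char_poly_mx A)^T = char_poly_mx A^T.
  by rewrite /char_poly_mx raddfB /= tr_scalar_mx map_trmx.
move=> eqA; set w := phi Q; set w' := phi (invmx Q).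
have ww' : w * w' = 1 by rewrite -rmorphM -[_ * _]/(Q *m invmx Q) mulmxV ?rmorph1.
have XA : ('X - A%:P) * w = phi (invmx P) * ('X - A^T%:P).
  rewrite -!phi_char -!rmorphM eqA; congr (phi _).
  by rewrite -[RHS]/(invmx P *m (P *m char_poly_mx A *m Q)) -!mulmxA mulKmx.
have XA' : ('X - A^T%:P) * w' = phi P * ('X - A%:P).
  rewrite -!phi_char -!rmorphM eqA; congr (phi _).
  by rewrite -[LHS]/(P *m char_poly_mx A *m Q *m invmx Q) mulmxK.
have twist (B C : 'M[F]_n.+1) (u v : {poly 'M[F]_n.+1}) :
    ('X - B%:P) * u = v * ('X - C%:P) -> u.[C] * C = B * u.[C].
  move=> eq_uv; have /rootP : root (('X - B%:P) * u) C.
    by rewrite eq_uv; apply/factor_theorem; exists v.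
  rewrite mulrBl -commr_polyX hornerD hornerN hornerMX hornerCM => /eqP.
  by rewrite subr_eq0 => /eqP.
have AM := twist _ _ _ _ XA; exists w.[A^T] => //.
have : w.[A^T] *m w'.[A] = 1%:M.
  by rewrite -[_ *m _](hornerM_twist w (twist _ _ _ _ XA')) ww' hornerC.
by case/mulmx1_unit.
Qed.

(** * Self-duality of subquotients *)

Section Subquotient.
Variables (F : fieldType) (n : nat) (A P Q : 'M[F]_n).
(* [P] and [Q] stand for their row spaces, on which [A] acts on the right. *)
Hypotheses (sPQ : (P <= Q)%MS) (stP : (P *m A <= P)%MS).

(** Coordinates on [Q / P]: the restriction to [Q] of the map [C] is onto, with
    kernel [P]. If [A] preserves [Q] as well as [P], then [B] is the matrix of
    the endomorphism of [Q / P] that it induces. *)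
Lemma subquotient_coords :
  exists (m : nat) (C : 'M[F]_(n, m)) (B : 'M[F]_m),
    [/\ forall K : 'M_n, (K <= Q)%MS -> (K *m C == 0) = (K <= P)%MS,
        row_full (Q *m C) & Q *m A *m C = Q *m C *m B].
Proof.
pose W := row_base (Q *m cokermx P); pose C := cokermx P *m pinvmx W.
have CW (K : 'M_n) : (K <= Q)%MS -> K *m C *m W = K *m cokermx P.
  by move=> sKQ; rewrite /C mulmxA mulmxKpV // eq_row_base submxMr.
have kerC (K : 'M_n) : (K <= Q)%MS -> (K *m C == 0) = (K <= P)%MS.
  move=> sKQ; rewrite submxE; apply/eqP/eqP=> [KC|].
    by rewrite -CW // KC mul0mx.
  by rewrite /C mulmxA => ->; rewrite mul0mx.
have fullQC : row_full (Q *m C).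
  rewrite /row_full eqn_leq rank_leq_col.
  by rewrite -{1}(CW Q) // mxrankM_maxl.
move: C kerC fullQC {CW} => C kerC fullQC.
(* [S *m Q] is a section of the projection [C] of [Q] onto its quotient. *)
have [S SQC] := row_fullP fullQC.
exists _, C, (S *m (Q *m A *m C)); split=> //.
apply/eqP; rewrite -subr_eq0 -[Q *m C *m _]mulmxA -[Q *m A *m C]mul1mx.
have -> : 1%:M *m (Q *m A *m C) - Q *m (C *m (S *m (1%:M *m (Q *m A *m C)))) =
  (Q - Q *m C *m S *m Q) *m A *m C by rewrite !mulmxBl !mul1mx !mulmxA.
have sDQ : (Q - Q *m C *m S *m Q <= Q)%MS by rewrite addmx_sub ?eqmx_opp ?submxMl.
have sDP : (Q - Q *m C *m S *m Q <= P)%MS.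
  by rewrite -kerC // mulmxBl -!mulmxA SQC mulmx1 subrr.
have sDAP : ((Q - Q *m C *m S *m Q) *m A <= P)%MS.
  exact: submx_trans (submxMr A sDP) stP.
by rewrite kerC // (submx_trans sDAP).
Qed.

(** The bilinear form with matrix [J] induces a nondegenerate form on [Q / P]; if
    [A] preserves [Q], the endomorphism of [Q / P] that it induces is its own
    adjoint. *)
Lemma adjoint_form : exists J : 'M[F]_n,
  [/\ P *m J = 0,
      forall K : 'M_n, (P <= K)%MS -> (K <= Q)%MS ->
        (\rank (Q *m J *m K^T) + \rank P = \rank K)%N
    & Q *m A *m J *m Q^T = Q *m J *m A^T *m Q^T].
Proof.
have [m [C [B [kerC fullQC QAC]]]] := subquotient_coords.
have [M uM BM] := similar_trmx B.
exists (C *m M *m C^T); split.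
- by move: (kerC P sPQ); rewrite submx_refl !mulmxA => /eqP->; rewrite !mul0mx.
- move=> K sPK sKQ.
  have -> : Q *m (C *m M *m C^T) *m K^T = Q *m C *m (M *m (K *m C)^T).
    by rewrite trmx_mul !mulmxA.
  rewrite (eqmxMfull _ fullQC) -mxrank_tr trmx_mul trmxK.
  rewrite mxrankMfree ?row_free_unit ?unitmx_tr //.
  rewrite -(mxrank_mul_ker K C); congr (_ + _)%N.
  apply: eqmx_rank; apply/andP; split.
    by rewrite sub_capmx sPK /=; apply/sub_kermxP/eqP; rewrite kerC.
  rewrite -kerC ?(submx_trans (capmxSl _ _)) //.
  by apply/eqP/sub_kermxP; rewrite capmxSr.
rewrite !mulmxA QAC.
have -> : Q *m C *m B *m M *m C^T *m Q^T = Q *m C *m M *m (Q *m C *m B)^T.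
  by rewrite !trmx_mul -!mulmxA; do 2![congr (_ *m _)]; rewrite !mulmxA BM.
by rewrite -QAC !trmx_mul !mulmxA.
Qed.

End Subquotient.

Section Duality.
Import VectorInternalTheory.
Variables (F : fieldType) (V : vectType F) (f : 'End(V)).
Implicit Types P Q R : {vspace V}.

(** [U] is an [f]-stable subspace. *)
Definition stablev U := (f @: U <= U)%VS.

Lemma stablev_mx U : stablev U = (vs2mx U *m f2mx f <= vs2mx U)%MS.
Proof. by rewrite /stablev unlock /subsetv mx2vsK. Qed.

(** The module [Q / P] over the polynomial ring is self-dual. Here [D R] is the
    orthogonal in [Q] of [R], for a form as in [adjoint_form]. *)
Lemma stable_interval_duality P Q : stablev P -> stablev Q -> (P <= Q)%VS ->
  exists D : {vspace V} -> {vspace V},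
    (forall R, stablev R -> (P <= R <= Q)%VS ->
       [/\ stablev (D R), (P <= D R <= Q)%VS
         & (\dim (D R) + \dim R = \dim P + \dim Q)%N]) /\
    (forall R R', (P <= R <= Q)%VS -> (P <= R' <= Q)%VS ->
       D R = D R' -> (R' <= R)%VS).
Proof.
rewrite !stablev_mx => stP stQ sPQ.
have [J [PJ rkJ adjJ]] := adjoint_form sPQ stP.
pose X (K : 'M_(dim V)) := (vs2mx Q :&: kermx (J *m K^T))%MS.
have rkX (K : 'M_(dim V)) : (vs2mx P <= K)%MS -> (K <= vs2mx Q)%MS ->
    (\rank (X K) + \rank K = \rank (vs2mx P) + \rank (vs2mx Q))%N.
  move=> sPK sKQ; rewrite -(mxrank_mul_ker (vs2mx Q) (J *m K^T)) mulmxA.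
  by rewrite -(rkJ K) // addnC addnCA addnA addnC addnA.
have adj (U W : 'M_(dim V)) : (U <= vs2mx Q)%MS -> (W <= vs2mx Q)%MS ->
    U *m f2mx f *m J *m W^T = U *m J *m (W *m f2mx f)^T.
  move=> /submxP[Y ->] /submxP[T ->].
  by have:= congr1 (fun M => Y *m M *m T^T) adjJ; rewrite /= !trmx_mul !mulmxA.
exists (fun R => mx2vs (X (vs2mx R))); split=> [R | R R'].
  rewrite !stablev_mx => stR /andP[sPR sRQ].
  have sXQ : (X (vs2mx R) <= vs2mx Q)%MS by apply: capmxSl.
  split.
  - rewrite (eqmxMr _ (mx2vsK _)) mx2vsK sub_capmx (submx_trans (submxMr _ sXQ) stQ) /=.
    apply/sub_kermxP.
    have [Z RZ] := submxP stR.
    have -> : X (vs2mx R) *m f2mx f *m (J *m (vs2mx R)^T) =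
        X (vs2mx R) *m (J *m (vs2mx R)^T) *m Z^T.
      by rewrite mulmxA adj // RZ trmx_mul !mulmxA.
    suff -> : X (vs2mx R) *m (J *m (vs2mx R)^T) = 0 by rewrite mul0mx.
    by apply/sub_kermxP; apply: capmxSr.
  - rewrite /subsetv !mx2vsK sXQ andbT sub_capmx.
    apply/andP; split=> //; apply/sub_kermxP.
    by rewrite mulmxA PJ mul0mx.
  by rewrite /dimv mx2vsK rkX.
move=> /andP[sPR sRQ] /andP[sPR' sRQ'] DRR'.
have sXX' : (X (vs2mx R) <= X (vs2mx R'))%MS.
  by rewrite -(mx2vsK (X (vs2mx R))) DRR' mx2vsK.
(* [R + R'] and [R] have the same orthogonal, hence the same dimension. *)
pose K := (vs2mx R + vs2mx R')%MS.
have sXK : (X (vs2mx R) <= X K)%MS.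
  have [[Y Y'] /= KE] := sub_addsmxP (submx_refl K).
  rewrite sub_capmx capmxSl; apply/sub_kermxP; rewrite KE linearD /=.
  rewrite !trmx_mul !mulmxDr !mulmxA.
  have: X (vs2mx R) *m (J *m (vs2mx R)^T) = 0 by apply/sub_kermxP/capmxSr.
  have: X (vs2mx R) *m (J *m (vs2mx R')^T) = 0.
    by apply/sub_kermxP/(submx_trans sXX')/capmxSr.
  by rewrite !mulmxA => -> ->; rewrite !mul0mx addr0.
have sRK : (vs2mx R <= K)%MS by apply: addsmxSl.
have sKQ : (K <= vs2mx Q)%MS by rewrite addsmx_sub; apply/andP.
have leKR : (\rank K <= \rank (vs2mx R))%N.
  rewrite -(leq_add2l (\rank (X K))) rkX ?(submx_trans sPR) // -(rkX (vs2mx R)) //.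
  by rewrite leq_add2r mxrankS.
have sKR : (K <= vs2mx R)%MS by rewrite -(geq_leqif (mxrank_leqif_sup sRK)).
by apply: submx_trans sKR; apply: addsmxSr.
Qed.

End Duality.

(** * Counting orbits by fixed points *)

Section Burnside.
Variables (G : groupType) (T : finType) (to : G -> T -> T).
Hypotheses (to1 : forall x, to 1%g x = x)
           (toM : forall g h x, to (g * h)%g x = to g (to h x)).

Lemma action_inj g : injective (to g).
Proof. by apply: (can_inj (g := to g^-1%g)) => x; rewrite -toM mulVg to1. Qed.

(** The permutation of [T] by which [g] acts. *)
Definition action_perm g : {perm T} := perm (@action_inj g).

(** The image of [G] in the symmetric group of [T]: a finite group with the same
    orbits as [G], even if [G] is infinite. *)
Definition action_image : {set {perm T}} :=
  [set p | `[< exists g, p = action_perm g >]].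

Lemma action_imageP p : reflect (exists g, p = action_perm g) (p \in action_image).
Proof. by rewrite inE; apply: asboolP. Qed.

Lemma group_set_action_image : group_set action_image.
Proof.
apply/group_setP; split=> [|p q /action_imageP[g ->] /action_imageP[h ->]].
  by apply/action_imageP; exists 1%g; apply/permP=> x; rewrite perm1 permE to1.
by apply/action_imageP; exists (h * g)%g; apply/permP=> x; rewrite permM !permE toM.
Qed.
Canonical action_image_group := Group group_set_action_image.

Lemma group_orbitE x : group_orbit to x = orbit 'P action_image x.
Proof.
apply/setP=> y; rewrite inE; apply/asboolP/orbitP=> [[g <-]|[p]].
  exists (action_perm g); last by rewrite /= /aperm permE.
  by apply/action_imageP; exists g.
by case/action_imageP=> g -> <-; exists g; rewrite /= /aperm permE.
Qed.

(** By the Cauchy-Frobenius formula, two stable sets on which each [g] has the same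
    number of fixed points have the same number of orbits. *)
Lemma norbits_eq (E1 E2 : {set T}) :
  (forall g x, x \in E1 -> to g x \in E1) ->
  (forall g x, x \in E2 -> to g x \in E2) ->
  (forall g, #|[set x in E1 | to g x == x]| = #|[set x in E2 | to g x == x]|) ->
  norbits to E1 = norbits to E2.
Proof.
have burnside (E : {set T}) : (forall g x, x \in E -> to g x \in E) ->
    (\sum_(p in action_image) #|[set x in E | p x == x]| =
     norbits to E * #|action_image|)%N.
  move=> stE; have acts : [acts action_image, on E | 'P].
    apply/subsetP=> p /action_imageP[g ->]; rewrite !inE; apply/subsetP=> x xE.
    by rewrite inE /= /aperm permE stE.
  rewrite /norbits (eq_imset _ group_orbitE) -(Frobenius_Cauchy acts).
  apply: eq_bigr => p _; apply: eq_card => x; rewrite !inE /=; congr (_ && _).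
  by rewrite sub1set inE.
move=> st1 st2 eq12; apply/eqP.
rewrite -(eqn_pmul2r (cardG_gt0 action_image_group)) /=.
rewrite -!burnside //; apply/eqP/eq_bigr => p /action_imageP[g ->].
rewrite -(eq_card (A := [set x in E1 | to g x == x])) => [|x].
  by rewrite eq12; apply: eq_card => x; rewrite !inE permE.
by rewrite !inE permE.
Qed.
End Burnside.

(** * Counting stable flags *)

Section Chains.
Variables (F : finFieldType) (V : vectType F) (f : 'End(V)).
Implicit Types (P Q R : {vspace V}) (x y : nat) (s t : seq nat).

(** [R] may follow [P] in an [f]-stable flag, with a part equal to [x]. *)
Definition flag_step x P R :=
  [&& stablev f R, (P <= R)%VS & \dim R - \dim P == x]%N.

(** The duality of [Q / P] exchanges its stable subspaces of dimension [x] and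
    those of dimension [y], where [x + y] is the dimension of [Q / P]. *)
Lemma flag_step_swap x y P Q : stablev f P -> stablev f Q ->
  #|[set R | flag_step x P R && flag_step y R Q]| =
  #|[set R | flag_step y P R && flag_step x R Q]|.
Proof.
move=> stP stQ.
suff le x' y' : (#|[set R | flag_step x' P R && flag_step y' R Q]| <=
    #|[set R | flag_step y' P R && flag_step x' R Q]|)%N.
  by apply/eqP; rewrite eqn_leq !le.
have [sPQ | nsPQ] := boolP (P <= Q)%VS; last first.
  rewrite (eq_card0 (A := [set R | _])) // => R; rewrite !inE; apply: contraNF nsPQ.
  by case/andP=> /and3P[_ sPR _] /and3P[_ sRQ _]; apply: subv_trans sPR sRQ.
have [D [DP Dinj]] := stable_interval_duality stP stQ sPQ.
rewrite -(card_in_imset (f := D)) => [|R R'].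
  apply/subset_leq_card/subsetP=> _ /imsetP[R + ->]; rewrite !inE.
  case/andP=> /and3P[stR sPR /eqP dPR] /and3P[_ sRQ /eqP dRQ].
  have [|stD /andP[sPD sDQ] dimD] := DP R stR; first by rewrite sPR.
  rewrite /flag_step stD sPD sDQ stQ /=.
  have dimDR : \dim (D R) = (\dim P + \dim Q - \dim R)%N by rewrite -dimD addnK.
  have dimQ : \dim Q = (\dim (D R) + \dim R - \dim P)%N by rewrite dimD addKn.
  by rewrite {1}dimDR subnAC addKn dRQ eqxx dimQ subnAC addKn dPR eqxx.
rewrite !inE => /andP[/and3P[_ sPR _] /and3P[_ sRQ _]].
move=> /andP[/and3P[_ sPR' _] /and3P[_ sRQ' _]] DRR'.
by apply/eqP; rewrite eqEsubv (Dinj R' R) ?(Dinj R R') ?sPR ?sPR'.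
Qed.

(** The number of [f]-stable flags from [P] to the whole space with parts [s]. *)
Fixpoint nchains s P : nat :=
  if s is x :: s' then (\sum_(R | flag_step x P R) nchains s' R)%N
  else P == fullv.

Lemma nchains_swap x y s P : stablev f P ->
  nchains [:: x, y & s] P = nchains [:: y, x & s] P.
Proof.
have count x' y' : nchains [:: x', y' & s] P =
    (\sum_(Q | stablev f Q)
       #|[set R | flag_step x' P R && flag_step y' R Q]| * nchains s Q)%N.
  rewrite /= (exchange_big_dep (stablev f)) /= => [|R Q _ /and3P[]//].
  by apply: eq_bigr => Q _; rewrite sum_nat_const cardsE.
by move=> stP; rewrite !count; apply: eq_bigr => Q stQ; rewrite flag_step_swap.
Qed.

Lemma nchains_perm s t P : stablev f P -> perm_eq s t -> nchains s P = nchains t P.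
Proof.
elim: s t P => [|x s IHs] t P stP.
  by rewrite perm_sym => /perm_nilP ->.
move=> pst; have xt : x \in t by rewrite -(perm_mem pst) mem_head.
case/splitPr: xt pst => t1 t2 pst.
have pst' : perm_eq s (t1 ++ t2).
  by rewrite -(perm_cons x) (perm_trans pst) // -cat1s perm_catCA.
have -> : nchains (t1 ++ x :: t2) P = nchains (x :: t1 ++ t2) P.
  elim: t1 P stP {pst pst'} => [//|y t1 IHt] P stP.
  rewrite -[RHS]nchains_swap //=; apply: eq_bigr => R /and3P[stR _ _].
  exact: IHt.
by apply: eq_bigr => R /and3P[stR _ _]; apply: IHs.
Qed.

(** The flags from [P] to the whole space with parts [a], all of whose terms but
    [P] are required to be [f]-stable. *)
Definition stable_flags r (a : 'I_r -> nat) P :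
    {set {ffun 'I_r.+1 -> {vspace V}}} :=
  [set h : {ffun 'I_r.+1 -> {vspace V}} |
    [&& h ord0 == P, h ord_max == fullv &
      [forall i : 'I_r,
        flag_step (a i) (h (widen_ord (leqnSn r) i)) (h (lift ord0 i))]]].

Lemma forall_ordS r (p : pred 'I_r.+1) :
  [forall i, p i] = p ord0 && [forall i, p (lift ord0 i)].
Proof.
apply/forallP/andP=> [pT | [p0 /forallP pS] i]; first by split=> //; apply/forallP.
by case: (unliftP ord0 i) => [j|] ->.
Qed.

Lemma card_stable_flags r (a : 'I_r -> nat) P :
  #|stable_flags a P| = nchains [seq a i | i <- enum 'I_r] P.
Proof.
elim: r a P => [|r IHr] a P.
  rewrite enum_ord0 /=; have [-> | nP] := eqVneq P fullv.
    suff -> : stable_flags a fullv = [set [ffun=> fullv]] by rewrite cards1.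
    apply/setP=> h; rewrite !inE; apply/idP/eqP=> [/and3P[/eqP h0 _ _] | ->].
      by apply/ffunP=> i; rewrite ord1 h0 ffunE.
    by rewrite !ffunE !eqxx; apply/forallP; case.
  apply: eq_card0 => h; rewrite !inE; apply: contraNF nP => /and3P[/eqP <- /eqP <- _].
  by rewrite [ord0]ord1 [ord_max]ord1.
rewrite enum_ordSl /= -map_comp.
(* Flags are sorted by their second term, which is the first one of their tail. *)
pose tl (h : {ffun 'I_r.+2 -> {vspace V}}) : {ffun 'I_r.+1 -> {vspace V}} :=
  [ffun i : 'I_r.+1 => h (lift ord0 i)].
pose cons (h : {ffun 'I_r.+1 -> {vspace V}}) : {ffun 'I_r.+2 -> {vspace V}} :=
  [ffun i : 'I_r.+2 => if unlift ord0 i is Some j then h j else P].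
pose second (h : {ffun 'I_r.+2 -> {vspace V}}) := h (lift ord0 ord0).
have widenS (i : 'I_r) :
    widen_ord (leqnSn r.+1) (lift ord0 i) = lift ord0 (widen_ord (leqnSn r) i).
  exact: val_inj.
have widen0 : widen_ord (leqnSn r.+1) ord0 = ord0 by apply: val_inj.
have maxS : ord_max = lift ord0 ord_max :> 'I_r.+2 by apply: val_inj.
have cons0 h : cons h ord0 = P by rewrite ffunE unlift_none.
have consS h i : cons h (lift ord0 i) = h i by rewrite ffunE liftK.
rewrite -sum1_card (partition_big second (flag_step (a ord0) P)) /=;
  last first.
  by move=> h; rewrite inE forall_ordS /second widen0 => /and3P[/eqP -> _ /andP[]].
apply: eq_bigr => R stepR; rewrite -IHr -sum1_card.
rewrite (reindex_onto cons tl) => [|h /andP[]]; last first.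
  rewrite inE => /and3P[/eqP h0 _ _] _; apply/ffunP=> i; rewrite ffunE.
  by case: unliftP => [j|] ->; rewrite ?ffunE.
apply: eq_bigl => h; rewrite !inE /second forall_ordS widen0 maxS !consS cons0 eqxx /=.
have -> : tl (cons h) == h by apply/eqP/ffunP=> i; rewrite ffunE consS.
rewrite andbT; under eq_forallb => i do rewrite widenS !consS.
rewrite andbC; have [-> | //] := eqVneq (h ord0) R.
by rewrite stepR.
Qed.

End Chains.

Theorem mainTheorem7 (F : finFieldType) (V : vectType F) (n : nat)
    (dimV : \dim {:V}%VS = n) (n_ge1 : (1 <= n)%N)
    (G : groupType) (rho : G -> 'End(V)) (rhoP : linear_action rho)
    (r : nat) (a : 'I_r -> nat) (aP : composition n a) (sigma : 'S_r) :
  norbits (flag_act rho (r := r)) (Fl V a) =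
  norbits (flag_act rho (r := r)) (Fl V (fun i => a (sigma i))).
Proof.
apply: norbits_eq.
- exact: flag_act1.
- exact: flag_actM.
- by move=> g x; apply: Fl_stable.
- by move=> g x; apply: Fl_stable.
move=> g.
have fixE U : (rho g @: U == U)%VS = stablev (rho g) U.
  rewrite /stablev eqEdim limg_dim_eq ?leqnn ?andbT //.
  by rewrite (eqP (lker_linear_action rhoP g)) capv0.
have fix_flags (b : 'I_r -> nat) :
    #|[set h in Fl V b | flag_act rho g h == h]| =
    nchains (rho g) [seq b i | i <- enum 'I_r] 0%VS.
  rewrite -card_stable_flags; apply: eq_card => h; rewrite !inE -!andbA.
  have [/= h0|//] := eqVneq (h ord0) _; have [_ /=|//] := eqVneq (h ord_max) _.
  apply/andP/forallP=> [[/forallP flag_h /eqP fix_h] i | stable_h].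
    rewrite /flag_step flag_h andbT -fixE; apply/eqP.
    by rewrite -[RHS](congr1 (fun h' => fun_of_fin h' _) fix_h) ffunE.
  split; first by apply/forallP=> i; case/andP: (stable_h i).
  apply/eqP/ffunP=> i; rewrite ffunE; apply/eqP; rewrite fixE.
  case: (unliftP ord0 i) => [j|] ->; first by case/andP: (stable_h j).
  by rewrite h0 -fixE limg0.
rewrite !fix_flags; apply: nchains_perm; first by rewrite -fixE limg0.
rewrite (map_comp a sigma) perm_sym; apply: perm_map; apply: uniq_perm.
- by rewrite map_inj_uniq ?enum_uniq //; apply: perm_inj.
- exact: enum_uniq.
move=> i; rewrite mem_enum; apply/mapP; exists (sigma^-1 i)%g; rewrite ?mem_enum //.
by rewrite permKV.
Qed.
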